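(* Let $k\in\mathbb{N}$, $r\in\{1,\dots,k\}$, and $m,m'\in\{0,\dots,k-r\}$. For every $f\in W_{krm}$ and $f'\in W_{krm'}$, $$ \mathbb{E}_{w\sim\mathcal{W}(n,\mathbf{p})}\left[\left(n^{r/2}\,\bar\# f(w)\right)\left(n^{r/2}\,\bar\# f'(w)\right)\right]\;\xrightarrow[n\to\infty]{}\;\frac{(k!)^2\,\langle f,f'\rangle_{\mathbf p}}{(k+m)!\,(k-r-m)!} . $$ In particular, if $m'\ne m$ then this limit is $\langle f,f'\rangle_{\mathbf p}=0$.
   Context: $\Sigma$ is a finite alphabet with $d=|\Sigma|\ge 2$, and $\mathbf{p}=(p_x)_{x\in\Sigma}$ with $p_x\in(0,1)$, $\sum_x p_x=1$. $\mathcal{W}(n,\mathbf{p})$ is the distribution of a random word $w\in\Sigma^n$ with independent letters, each equal to $x$ with probability $p_x$. For $u\in\Sigma^k$, $w\in\Sigma^n$ ($n\ge k$), $\#u(w)$ is the number of tuples $1\le t_1<\dots<t_k\le n$ with $w_{t_1}\cdots w_{t_k}=u$, and $\bar\#u(w)=\#u(w)/\binom nk$. Let $W_k=\mathbb{R}\Sigma^k$ be the space of formal real combinations $f=\sum_{u\in\Sigma^k}f_u u$; extend $\bar\#$ linearly: $\bar\#f=\sum_u f_u\bar\#u$. Inner product on $W_k$: $\langle f,f'\rangle_{\mathbf p}=\sum_{u\in\Sigma^k}p_uf_uf'_u$, where $p_u=p_{u_1}\cdots p_{u_k}$. In $\mathbb{R}\Sigma=W_1$ let $\mathbf{1}:=\sum_{x\in\Sigma}x$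 and complete it to an orthonormal basis $D=\{\mathbf 1,\mathbf 2,\dots,\mathbf d\}$ of $W_1$ with respect to $\langle\cdot,\cdot\rangle_{\mathbf p}$. Using bilinear concatenation, every word $e=e_1\cdots e_k\in D^k$ is an element of $W_k$, and $D^k$ is an orthonormal basis of $W_k$. Define $W_{kr}=\mathrm{span}\{e\in D^k: \text{exactly } k-r \text{ letters of } e \text{ equal } \mathbf 1\}$. The deletion operator $\partial:W_k\to W_{k-1}$ is the linear map sending each basis word $e\in D^k$ to the sum, over all positions $i$ with $e_i=\mathbf 1$, of the word obtained from $e$ by deleting its $i$-th letter ($0$ if there is no such position). $\partial^j$ denotes its $j$-fold iterate ($\partial^0$ is the identity). For $m\in\{0,\dots,k-r\}$ define $$W_{krm}=\left(\ker\partial^{\,k-r-m+1}\right)\cap\left(\ker\partial^{\,k-r-m}\right)^{\perp}\subseteq W_{kr},$$ where kernels are those of the restrictions to $W_{kr}$ and the orthogonal complement is taken in $W_{kr}$ with respect to $\langle\cdot,\cdot\rangle_{\mathbf p}$. *)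

(* Defs.v *)
From HB Require Import structures.
From mathcomp Require Import all_boot all_order all_algebra.
From mathcomp Require Import all_classical all_reals all_analysis.

Set Implicit Arguments.
Unset Strict Implicit.
Unset Printing Implicit Defensive.

Import Order.TTheory GRing.Theory Num.Theory.
Import numFieldNormedType.Exports.

Local Open Scope ring_scope.

(* [R^o] is [R] seen as a vector space over itself, so that [Wspace R S k] is
   a finite-dimensional vector space ([vectType R]). *)
Notation Wspace R S k := {ffun k.-tuple S -> R^o}.

Definition wordp (R : realType) (S : finType) (p : S -> R) (k : nat)
  (u : k.-tuple S) : R := \prod_(i < k) p (tnth u i).

Definition expect_word (R : realType) (S : finType) (p : S -> R) (n : nat)
  (X : n.-tuple S -> R) : R := \sum_(w : n.-tuple S) wordp p w * X w.

Definition occ (S : finType) (k n : nat) (u : k.-tuple S) (w : n.-tuple S)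
  : nat :=
  #|[set t : k.-tuple 'I_n
      | sorted ltn (map val t) && (map_tuple (tnth w) t == u)]|.

(* For [n < k] the binomial vanishes and the quotient is [0]; only [n >= k] is
   meaningful. *)
Definition density (R : realType) (S : finType) (k n : nat)
  (u : k.-tuple S) (w : n.-tuple S) : R := (occ u w)%:R / 'C(n, k)%:R.

Definition densityW (R : realType) (S : finType) (k n : nat)
  (f : Wspace R S k) (w : n.-tuple S) : R :=
  \sum_(u : k.-tuple S) f u * density R u w.

Definition inner (R : realType) (S : finType) (p : S -> R) (k : nat)
  (f g : Wspace R S k) : R :=
  \sum_(u : k.-tuple S) wordp p u * f u * g u.

(* The letters of [D] are indexed by ['I_#|S|]; index [0] is the letter
   [1 = \sum_x x], all of whose coefficients equal [1]. *)
Definition orthonormal_basis1 (R : realType) (S : finType) (p : S -> R)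
  (D : 'I_#|S| -> Wspace R S 1) : Prop :=
  [/\ forall i : 'I_#|S|, val i = 0%N -> D i = [ffun=> 1],
      forall i j : 'I_#|S|, inner p (D i) (D j) = (i == j)%:R
    & basis_of fullv [tuple D i | i < #|S|]].

(* The concatenation [D e_1 ... D e_k], expanded by multilinearity: the
   coefficient of the word [u] is the product of the coefficients of the
   letters [u_i] in [D e_i]. *)
Definition concat (R : realType) (S : finType) (D : 'I_#|S| -> Wspace R S 1)
  (k : nat) (e : k.-tuple 'I_#|S|) : Wspace R S k :=
  [ffun u : k.-tuple S => \prod_(i < k) D (tnth e i) [tuple tnth u i]].

Definition Wkr (R : realType) (S : finType) (D : 'I_#|S| -> Wspace R S 1)
  (k r : nat) : {vspace Wspace R S k} :=
  <<[seq concat D e | e : k.-tuple 'I_#|S| in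
      [set e : k.-tuple 'I_#|S|
        | #|[set i : 'I_k | val (tnth e i) == 0%N]| == (k - r)%N]]>>%VS.

Definition delete_at (T : Type) (k : nat) (i : 'I_k) (e : k.-tuple T)
  : k.-1.-tuple T := [tuple tnth e (lift i j) | j < k.-1].

Definition deletion_word (R : realType) (S : finType)
  (D : 'I_#|S| -> Wspace R S 1) (k : nat) (e : k.-tuple 'I_#|S|)
  : Wspace R S k.-1 :=
  \sum_(i < k | val (tnth e i) == 0%N) concat D (delete_at i e).

(* Linear extension of [deletion_word]: since [D^k] is orthonormal, the
   coordinate of [f] on [e] is [inner p f e]. See [deletion_concat]. *)
Definition deletion (R : realType) (S : finType) (p : S -> R)
  (D : 'I_#|S| -> Wspace R S 1) (k : nat) (f : Wspace R S k)
  : Wspace R S k.-1 :=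
  \sum_(e : k.-tuple 'I_#|S|) inner p f (concat D e) *: deletion_word D e.

(* [iter j predn k] is [k - j], in the form that makes the iteration typecheck
   without casts. *)
Fixpoint deletion_iter (R : realType) (S : finType) (p : S -> R)
  (D : 'I_#|S| -> Wspace R S 1) (k j : nat) (f : Wspace R S k)
  : Wspace R S (iter j predn k) :=
  match j with
  | 0 => f
  | j'.+1 => deletion p D (deletion_iter p D j' f)
  end.

Definition Wkrm (R : realType) (S : finType) (p : S -> R)
  (D : 'I_#|S| -> Wspace R S 1) (k r m : nat) (f : Wspace R S k) : Prop :=
  [/\ f \in Wkr D k r,
      deletion_iter p D (k - r - m).+1 f = 0
    & forall g : Wspace R S k, g \in Wkr D k r ->
        deletion_iter p D (k - r - m) g = 0 -> inner p f g = 0].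

Lemma deletion_is_linear (R : realType) (S : finType) (p : S -> R)
  (D : 'I_#|S| -> Wspace R S 1) (k : nat) : linear (@deletion R S p D k).
Proof.
move=> a f g; rewrite /deletion scaler_sumr -big_split; apply: eq_bigr => e _.
rewrite scalerA /= -scalerDl; congr (_ *: _).
rewrite /inner mulr_sumr -big_split; apply: eq_bigr => u _.
rewrite !ffunE /= mulrDr mulrDl; congr (_ + _).
by rewrite -[a *: _]/(a * _) mulrCA !mulrA.
Qed.

HB.instance Definition _ (R : realType) (S : finType) (p : S -> R)
  (D : 'I_#|S| -> Wspace R S 1) (k : nat) :=
  GRing.isLinear.Build R (Wspace R S k) (Wspace R S k.-1) *:%R
    (@deletion R S p D k) (deletion_is_linear p D (k := k)).

Lemma inner_concat (R : realType) (S : finType) (p : S -> R)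
  (D : 'I_#|S| -> Wspace R S 1) (k : nat) (e e' : k.-tuple 'I_#|S|) :
  orthonormal_basis1 p D -> inner p (concat D e) (concat D e') = (e == e')%:R.
Proof.
case=> _ onD _.
have inner1 i j : \sum_(x : S) p x * D i [tuple x] * D j [tuple x]
    = (i == j)%:R.
  rewrite -onD /inner (reindex (fun x : S => [tuple x])) /=.
    by apply: eq_bigr => x _; rewrite /wordp big_ord1 !(tnth_nth x).
  exists (fun t : 1.-tuple S => thead t) => t _ //.
  by rewrite [t]tuple_eta; case: t => -[|x [|]] //= ? ; apply: val_inj.
rewrite /inner.
transitivity (\prod_(i < k) (tnth e i == tnth e' i)%:R : R).
  under [RHS]eq_bigr do rewrite -inner1.
  rewrite bigA_distr_bigA /=.
  rewrite (reindex (fun f : {ffun 'I_k -> S} => [tuple f i | i < k])) /=.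
    apply: eq_bigr => f _; rewrite /wordp !ffunE -!big_split /=.
    by apply: eq_bigr => i _; rewrite !tnth_mktuple.
  exists (fun t : k.-tuple S => [ffun i => tnth t i]) => t _.
    by apply/ffunP => i; rewrite ffunE tnth_mktuple.
  by apply: eq_from_tnth => i; rewrite tnth_mktuple ffunE.
have [->|neq] := eqVneq e e'; first by rewrite big1 // => i _; rewrite eqxx.
have [i /negPf ne_i] : exists i, tnth e i != tnth e' i.
  apply/existsP; rewrite -negb_forall; apply: contra neq => /forallP eqe.
  by apply/eqP/eq_from_tnth => i; apply/eqP.
by rewrite (bigD1 i) //= ne_i mul0r.
Qed.

Lemma deletion_concat (R : realType) (S : finType) (p : S -> R)
  (D : 'I_#|S| -> Wspace R S 1) (k : nat) (e : k.-tuple 'I_#|S|) :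
  orthonormal_basis1 p D -> deletion p D (concat D e) = deletion_word D e.
Proof.
move=> onD; rewrite /deletion (bigD1 e) //= inner_concat // eqxx scale1r.
rewrite big1 ?addr0 // => e' ne; rewrite inner_concat //.
by rewrite eq_sym (negPf ne) scale0r.
Qed.

(* Main.v *)
(* Expanding in words over the orthonormal letters, [E (#e #e')] counts the
   pairs of occurrences of [e] and [e'] which share the positions of their
   letters other than [1]. Sorted by the number [i] of covered positions this is
   a sum of [C(n, i)]; for [f], [f'] in [W_kr] the leading index is
   [i = 2 k - r], and there the number of shuffles is, by Vandermonde's identity,
   [sum_j <d^j f, d^j f'> / j!^2], where [d] is the deletion operator. The
   operator [d] and its adjoint [d'] satisfy the commutation relation of sl2, and
   [W_krm] is [d'^(k-r-m)] applied to [ker d] at level [m]. Hence [d'^j d^j] is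
   an explicit scalar on [W_krm], and a second use of Vandermonde's identity sums
   these scalars to [C(2 k - r, k - r - m)]. *)

Require Import Defs.
From HB Require Import structures.
From mathcomp Require Import all_boot all_order all_algebra.
From mathcomp Require Import all_classical all_reals all_analysis.
From mathcomp Require Import ring lra zify.

Set Implicit Arguments.
Unset Strict Implicit.
Unset Printing Implicit Defensive.

Import Order.TTheory GRing.Theory Num.Theory.
Import numFieldNormedType.Exports.

Local Open Scope ring_scope.

(** * The deletion operator and its adjoint *)

Section Words.
Variables (R : realFieldType) (T : finType) (o : T).
Implicit Types (c d h : seq T -> R) (v e b : seq T).

Lemma big_tuple0 (F : seq T -> R) : \sum_(v : 0.-tuple T) F v = F [::].
Proof.
rewrite (big_pred1 [tuple]) // => v /=; apply/esym/eqP; exact: tuple0.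
Qed.

Lemma big_tupleS n (F : seq T -> R) :
  \sum_(v : n.+1.-tuple T) F v = \sum_x \sum_(v : n.-tuple T) F (x :: v).
Proof.
rewrite pair_big /= (reindex (fun q : T * n.-tuple T => [tuple of q.1 :: q.2])) //=.
exists (fun t => (thead t, [tuple of behead t])) => [[x v] _|t _] /=.
  by congr pair; apply: val_inj.
by rewrite [RHS]tuple_eta.
Qed.

(* A vector is represented by its coordinates [c] on all words, of any length.
   The coordinate of the deletion of [c] on [v] is the sum of [c] over the
   insertions of the letter [o] in [v]. *)
Fixpoint del c v : R :=
  c (o :: v) + if v is x :: v' then del (fun u => c (x :: u)) v' else 0.

(* The adjoint of [del]; see [ip_del]. *)
Fixpoint ins c v : R :=
  if v is x :: v' then (x == o)%:R * c v' + ins (fun u => c (x :: u)) v' else 0.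

Lemma del_lin a c d :
  del (fun v => c v + a * d v) = (fun v => del c v + a * del d v).
Proof.
apply/funext => v; elim: v c d => [|x v IH] c d /=; first by ring.
by rewrite IH; ring.
Qed.

Lemma ins_lin a c d :
  ins (fun v => c v + a * d v) = (fun v => ins c v + a * ins d v).
Proof.
apply/funext => v; elim: v c d => [|x v IH] c d /=; first by ring.
by rewrite IH; ring.
Qed.

Lemma del0 : del (fun=> 0) = (fun=> 0).
Proof.
apply/funext => v; elim: v => [|x v IH] /=; first by ring.
by rewrite IH; ring.
Qed.

Lemma ins0 : ins (fun=> 0) = (fun=> 0).
Proof.
apply/funext => v; elim: v => [|x v IH] //=.
by rewrite IH; ring.
Qed.

Lemma delZ a c : del (fun v => a * c v) = (fun v => a * del c v).
Proof.
have := del_lin a (fun=> 0) c; rewrite del0.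
by under eq_fun do rewrite add0r; under [RHS]eq_fun do rewrite add0r.
Qed.

Lemma insZ a c : ins (fun v => a * c v) = (fun v => a * ins c v).
Proof.
have := ins_lin a (fun=> 0) c; rewrite ins0.
by under eq_fun do rewrite add0r; under [RHS]eq_fun do rewrite add0r.
Qed.

Lemma iter_del_lin i a c d :
  iter i del (fun v => c v + a * d v) =
  (fun v => iter i del c v + a * iter i del d v).
Proof. by elim: i => //= i ->; rewrite del_lin. Qed.

Lemma iter_del0 i : iter i del (fun=> 0) = (fun=> 0).
Proof. by elim: i => //= i ->; rewrite del0. Qed.

Lemma iter_ins0 i : iter i ins (fun=> 0) = (fun=> 0).
Proof. by elim: i => //= i ->; rewrite ins0. Qed.

Lemma iter_insZ i a c : iter i ins (fun v => a * c v) = (fun v => a * iter i ins c v).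
Proof. by elim: i => //= i ->; rewrite insZ. Qed.


Lemma delD c d : del (fun v => c v + d v) = (fun v => del c v + del d v).
Proof.
have := del_lin 1 c d.
by under eq_fun do rewrite mul1r; under [RHS]eq_fun do rewrite mul1r.
Qed.

Lemma insD c d : ins (fun v => c v + d v) = (fun v => ins c v + ins d v).
Proof.
have := ins_lin 1 c d.
by under eq_fun do rewrite mul1r; under [RHS]eq_fun do rewrite mul1r.
Qed.

(* The commutation relation of sl2: [size v + count_mem o v] is [r + 2 N] on [hom r N]. *)
Lemma del_ins c v :
  del (ins c) v = ins (del c) v + (size v + count_mem o v).+1%:R * c v.
Proof.
elim: v c => [|x v IH] c /=; first by rewrite eqxx addn0 /= !addr0 add0r.
rewrite (delD (fun u => _ * c u)) delZ IH eqxx.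
rewrite (insD (fun u => c [:: o, x & u])).
have -> : ((size v).+1 + ((x == o) + count_mem o v)).+1 =
  ((size v + count_mem o v).+1 + 1 + (x == o))%N by lia.
by rewrite !natrD; case: eqVneq => [->|_] /=; ring.
Qed.

(* [N] letters equal to [o] and [r] other letters: the support of [W_(r+N) r]. *)
Definition hom r N c := forall v, c v != 0 -> count_mem o v = N /\ size v = (r + N)%N.

Lemma homP r N c v : hom r N c -> c v = 0 \/ (count_mem o v = N /\ size v = (r + N)%N).
Proof. by move=> hc; have [|/hc] := eqVneq (c v) 0; [left|right]. Qed.

Lemma ins_neq0 c v : ins c v != 0 ->
  exists2 b, c b != 0 & count_mem o v = (count_mem o b).+1 /\ size v = (size b).+1.
Proof.
elim: v c => [|x v IH] c /=; first by rewrite eqxx.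
have [->|xo] := eqVneq x o; last first.
  rewrite mul0r add0r => /IH [b cb [-> ->]]; exists (x :: b) => //=.
  by rewrite (negPf xo).
have [->|cv _] := eqVneq (c v) 0; last by exists v.
by rewrite mulr0 add0r => /IH [b cb [-> ->]]; exists (o :: b); rewrite //= eqxx.
Qed.

Lemma del_neq0 c v : del c v != 0 ->
  exists2 b, c b != 0 & count_mem o b = (count_mem o v).+1 /\ size b = (size v).+1.
Proof.
elim: v c => [|x v IH] c /=.
  by rewrite addr0 => co; exists [:: o] => //=; rewrite eqxx.
have [->|cv _] := eqVneq (c (o :: x :: v)) 0; last first.
  by exists (o :: x :: v); rewrite //= eqxx.
rewrite add0r => /IH [b cb /= [eb sb]]; exists (x :: b) => //=.
by rewrite eb sb addnS.
Qed.

Lemma hom_ins r N c : hom r N c -> hom r N.+1 (ins c).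
Proof. by move=> hc v /ins_neq0[b /hc[eb sb] [-> ->]]; rewrite eb sb addnS. Qed.

Lemma hom_del r N c : hom r N.+1 c -> hom r N (del c).
Proof. by move=> hc v /del_neq0[b /hc[-> ->] [[->] ]]; rewrite addnS => -[->]. Qed.

Lemma hom_iter_ins r N i c : hom r N c -> hom r (i + N) (iter i ins c).
Proof. by move=> hc; elim: i => //= i /hom_ins. Qed.

Lemma hom_iter_del r N i c : hom r (i + N) c -> hom r N (iter i del c).
Proof.
elim: i N => //= i IH N; rewrite addSnnS => /IH; exact: hom_del.
Qed.

Lemma hom_lin r N c d a : hom r N c -> hom r N d -> hom r N (fun v => c v + a * d v).
Proof.
move=> hc hd v; case: (homP v hc) => // ->; case: (homP v hd) => // ->.
by rewrite mulr0 addr0 eqxx.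
Qed.

(** Each time [del] is commuted past an [ins], [del_ins] contributes a scalar: on [hom r (m + j)] it
    is [r + 2 m + 2 j + 1]. Since [del h = 0], only these scalars remain, and their sum over
    [j <= l] is the stated product. *)
Lemma del_iter_ins r m h l : hom r m h -> del h = (fun=> 0) ->
  del (iter l.+1 ins h) = fun v => (l.+1 * (2 * m + r + l.+1))%:R * iter l ins h v.
Proof.
move=> hh dh; elim: l => [|l IH]; apply/funext => v; rewrite /= del_ins.
  rewrite dh ins0 add0r; case: (homP v hh) => [->|[-> ->]]; first by rewrite !mulr0.
  by congr (_%:R * _); ring.
rewrite -/(iter l.+1 ins h) IH insZ -/(iter l.+1 ins h).
have [->|[-> ->]] := homP v (@hom_iter_ins _ _ l.+1 _ hh); first by rewrite !mulr0 addr0.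
by rewrite -mulrDl -natrD; congr (_%:R * _); ring.
Qed.

(** The scalars of [del_iter_ins] for [M], [M - 1], ..., [M - i + 1] multiply to two falling
    factorials. *)
Lemma iter_del_iter_ins r m h M i : hom r m h -> del h = (fun=> 0) -> (i <= M)%N ->
  iter i del (iter M ins h) =
  fun v => (M ^_ i * (2 * m + r + M) ^_ i)%:R * iter (M - i) ins h v.
Proof.
move=> hh dh; elim: i => [|i IH] iM.
  by rewrite !ffactn0 subn0; apply/funext => v; rewrite /= mul1r.
rewrite /= IH 1?ltnW // delZ subnS.
have -> : (M - i)%N = (M - i).-1.+1 by rewrite prednK // subn_gt0.
rewrite (del_iter_ins _ hh dh) prednK ?subn_gt0 //=; apply/funext => v.
rewrite mulrA -natrM; congr (_%:R * _); rewrite !ffactnSr.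
have -> : (2 * m + r + M - i = 2 * m + r + (M - i))%N by lia.
by ring.
Qed.

Definition ip k c d : R := \sum_(v : k.-tuple T) c v * d v.

Lemma ipE0 c d : ip 0 c d = c [::] * d [::].
Proof. by rewrite /ip (big_tuple0 (fun v => c v * d v)). Qed.

Lemma ipES k c d :
  ip k.+1 c d = \sum_x ip k (fun v => c (x :: v)) (fun v => d (x :: v)).
Proof. by rewrite /ip (big_tupleS _ (fun v => c v * d v)). Qed.

Lemma ipDl k c c' d : ip k (fun v => c v + c' v) d = ip k c d + ip k c' d.
Proof. by rewrite /ip -big_split; apply: eq_bigr => v _; rewrite mulrDl. Qed.

Lemma ipZl k a c d : ip k (fun v => a * c v) d = a * ip k c d.
Proof. by rewrite /ip mulr_sumr; apply: eq_bigr => v _; rewrite mulrA. Qed.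

Lemma ipC k c d : ip k c d = ip k d c.
Proof. by apply: eq_bigr => v _; rewrite mulrC. Qed.

Lemma ip0l k d : ip k (fun=> 0) d = 0.
Proof. by rewrite /ip big1 // => v _; rewrite mul0r. Qed.

(** Inserting [o] in front on the left matches deleting a leading [o] on the right; insertions and
    deletions further inside are matched by induction on the length. *)
Lemma ip_del k c d : ip k (del c) d = ip k.+1 c (ins d).
Proof.
elim: k c d => [|k IH] c d.
  rewrite ipES ipE0 (bigD1 o) //= big1 => [|x /negPf xo]; rewrite ipE0 /=.
    by rewrite eqxx /= !addr0 mul1r.
  by rewrite xo mul0r add0r mulr0.
rewrite ipES [RHS]ipES.
under eq_bigr => x _ do rewrite /= ipDl IH.
under [RHS]eq_bigr => x _ do rewrite /= ipC ipDl ipZl !(ipC k.+1 _ (fun v => c (x :: v))).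
rewrite !big_split /=; congr (_ + _).
rewrite [RHS](bigD1 o) //= [X in _ = _ + X]big1 => [|x /negPf ->]; last by rewrite mul0r.
by rewrite eqxx mul1r addr0 ipES.
Qed.

Lemma ip_iter_del k i c d : ip k (iter i del c) d = ip (i + k) c (iter i ins d).
Proof.
elim: i k d => // i IH k d; rewrite iterS ip_del IH addnS addSn.
by rewrite -iterSr.
Qed.

(** Homogeneity confines [c] to words of the single length [r + N], so the inner product at this
    length sees every coordinate. *)
Lemma ip_eq0 r N c : hom r N c -> ip (r + N) c c = 0 -> c = (fun=> 0).
Proof.
move=> hc /eqP; rewrite /ip psumr_eq0 => [/allP /= H|v _]; last exact: sqr_ge0.
apply/funext => v; apply/eqP/contraT => cv; have [_ /eqP sv] := hc v cv.
have := H (Tuple sv) (mem_index_enum _).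
by rewrite /= mulf_eq0 orbb (negPf cv).
Qed.

(* [c] differs from a multiple of [ins^M (del^M c)] by an element of
   [ker del^M], which is orthogonal to both. *)
Lemma primitive_decomposition r m M c : hom r (m + M) c ->
  iter M.+1 del c = (fun=> 0) ->
  (forall g, hom r (m + M) g -> iter M del g = (fun=> 0) -> ip (r + (m + M)) c g = 0) ->
  exists h, [/\ hom r m h, del h = (fun=> 0) & c = iter M ins h].
Proof.
move=> hc dc oc; set h := iter M del c.
have hh : hom r m h by apply: hom_iter_del; rewrite addnC.
(* The scalar by which [del^M ins^M] acts on [h], from [iter_del_iter_ins] with [i = M]; the vector
   sought is [l^-1 * h]. *)
pose l : R := (M ^_ M * (2 * m + r + M) ^_ M)%:R.
have l0 : l != 0.
  by rewrite pnatr_eq0 -lt0n muln_gt0 !ffact_gt0 leqnn leq_addl.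
have hg : hom r (m + M) (iter M ins h) by rewrite addnC; exact: hom_iter_ins.
pose g v := c v + - l^-1 * iter M ins h v.
have homg : hom r (m + M) g by exact: hom_lin.
have dg : iter M del g = (fun=> 0).
  rewrite /g iter_del_lin (iter_del_iter_ins hh dc (leqnn M)) subnn /=.
  by apply/funext => v; rewrite -/l -/h mulrA mulNr mulVf // mulN1r subrr.
have g0 : g = (fun=> 0).
  apply: (ip_eq0 homg).
  rewrite {1}/g ipDl oc // ipZl ipC.
  have -> : (r + (m + M) = M + (r + m))%N by lia.
  by rewrite -ip_iter_del dg ip0l mulr0 addr0.
exists (fun v => l^-1 * h v); split.
- move=> v; rewrite mulf_eq0 negb_or => /andP[_]; exact: hh.
- by rewrite delZ [del h]dc; apply/funext => v; rewrite mulr0.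
- rewrite iter_insZ; apply/funext => v; apply/eqP; rewrite -subr_eq0 -mulNr.
  by rewrite -[_ + _]/(g v) g0.
Qed.

(** By adjointness the [i]-th inner product is that of [ins^i del^i c] with [d]. Writing
    [c = ins^M h] shows that [ins^i del^i] multiplies [c] by two falling factorials, which [i!^2]
    turns into binomials; Vandermonde's identity sums them. *)
Lemma sum_ip_iter_del r m M c d : hom r (m + M) c ->
  iter M.+1 del c = (fun=> 0) ->
  (forall g, hom r (m + M) g -> iter M del g = (fun=> 0) -> ip (r + (m + M)) c g = 0) ->
  \sum_(i < (r + (m + M)).+1)
     (i`!%:R ^- 2) * ip (r + (m + M) - i) (iter i del c) (iter i del d) =
  'C(r + 2 * (m + M), M)%:R * ip (r + (m + M)) c d.
Proof.
move=> hc dc oc; have [h [hh dh ch]] := primitive_decomposition hc dc oc.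
set k := (r + (m + M))%N.
have term i : (i < k.+1)%N -> (i`!%:R ^- 2) * ip (k - i) (iter i del c) (iter i del d) =
    ('C(M, i) * 'C(2 * m + r + M, i))%:R * ip k c d.
  move=> ik; rewrite ipC ip_iter_del subnKC //.
  (* For [i > M] both sides vanish, since [del^i c = 0] and ['C(M, i) = 0]. *)
  have [iM|Mi] := leqP i M; last first.
    have -> : iter i del c = (fun=> 0) by rewrite -(subnK Mi) iterD dc iter_del0.
    by rewrite iter_ins0 ipC ip0l bin_small // mul0n mul0r mulr0.
  rewrite ch (iter_del_iter_ins hh dh iM) iter_insZ -iterD subnKC // ipC ipZl.
  rewrite -!bin_ffact mulrA; congr (_ * _).
  rewrite !natrM; field.
  by rewrite pnatr_eq0 -lt0n fact_gt0.
under eq_bigr => i _ do rewrite term //.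
rewrite -mulr_suml -natr_sum; congr (_%:R * _).
have -> : (r + 2 * (m + M) = M + (2 * m + r + M))%N by lia.
rewrite -binomial.Vandermonde.
(* The terms with [i > M] are zero; the reflection of [i] to [M - i] then gives the form of
   Vandermonde's identity. *)
transitivity (\sum_(i < M.+1) 'C(M, i) * 'C(2 * m + r + M, i))%N.
  rewrite -!(big_mkord predT (fun i => 'C(M, i) * 'C(2 * m + r + M, i))%N).
  have -> : (k.+1 = M.+1 + (k - M))%N by rewrite /k; lia.
  rewrite /index_iota !subn0 iotaD big_cat /= [X in (_ + X)%N = _]big_seq_cond.
  rewrite [X in (_ + X)%N = _]big1 ?addn0 // => i.
  by rewrite andbT mem_iota => /andP[Mi _]; rewrite bin_small.
rewrite [RHS](reindex_inj rev_ord_inj); apply: eq_bigr => i _ /=.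
rewrite subSS subKn -1?ltnS // bin_sub // -ltnS //.
Qed.

End Words.

(** * Overlapping shuffles *)

Section Shuffle.
Variables (R : realFieldType) (T : finType) (o : T).
Implicit Types (c d : seq T -> R) (v e b : seq T).

(* The number of ways to obtain [b] by deleting letters [o] from [e]. *)
Fixpoint dels e b : R :=
  match e with
  | [::] => (nilp b)%:R
  | x :: e' => (x == o)%:R * dels e' b +
      if b is y :: b' then (x == y)%:R * dels e' b' else 0
  end.

Lemma dels_gt_size e b : (size e < size b)%N -> dels e b = 0.
Proof.
elim: e b => [|x e IH] [|y b] //= lt_eb.
by rewrite !IH ?mulr0 ?addr0 //= ltnW.
Qed.

(** Obtaining from [e] a word that is [b] with one more [o] amounts to obtaining [b] and marking one
    of the [size e - size b] deleted letters as put back; the gap of [b] into which it falls is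
    determined. *)
Lemma del_dels e b :
  del o (dels e) b = ((size e)%:R - (size b)%:R) * dels e b.
Proof.
elim: e b => [|x e IH] b.
  by case: b => [|y b] /=; [ring | rewrite (_ : del o _ b = 0); [ring|exact: (congr1 (@^~ b) (del0 R o))]].
case: b => [|y b] /=.
  have := IH [::]; rewrite /= !addr0 => ->.
  by case: eqVneq => _; rewrite -?[(size e).+1%:R]natr1 /=; ring.
have -> : del o (fun u => (x == o)%:R * dels e (y :: u) + (x == y)%:R * dels e u) b
  = (x == o)%:R * del o (fun u => dels e (y :: u)) b + (x == y)%:R * del o (dels e) b.
  rewrite (delD o (fun u => (x == o)%:R * dels e (y :: u))).
  by rewrite (delZ o _ (fun u => dels e (y :: u))) (delZ o _ (dels e)).
have E : del o (fun u => dels e (y :: u)) b =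
   ((size e)%:R - (size b).+1%:R) * dels e (y :: b) - dels e [:: o, y & b].
  by have H := IH (y :: b); rewrite /= in H; rewrite -H; ring.
rewrite E.
by rewrite IH -!natr1; case: (x == o); case: (x == y) => /=; ring.
Qed.

Lemma eq_del c d v : (forall u, size u = (size v).+1 -> c u = d u) ->
  del o c v = del o d v.
Proof.
elim: v c d => [|x v IH] c d cd /=; first by rewrite cd.
by rewrite cd // (IH _ (fun u => d (x :: u))) // => u su; rewrite cd //= su.
Qed.

Lemma del_sum (I : finType) (a : I -> R) (F : I -> seq T -> R) v :
  del o (fun u => \sum_i a i * F i u) v = \sum_i a i * del o (F i) v.
Proof.
elim: v F => [|x v IH] F /=.
  by rewrite addr0; apply: eq_bigr => i _; rewrite addr0.
by rewrite IH -big_split; apply: eq_bigr => i _; rewrite mulrDr.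
Qed.

(** Iterating [del_dels] yields the factors [1, ..., i]: the [i] letters deleted from a word of
    length [k] can be removed in [i!] orders. *)
Lemma iter_del_dels c k i b : size b = (k - i)%N -> (i <= k)%N ->
  iter i (del o) c b = i`!%:R * \sum_(e : k.-tuple T) c e * dels e b.
Proof.
elim: i b => [|i IH] b sb ik.
  rewrite /= mul1r; rewrite subn0 in sb.
  have dels_id : forall e, size e = size b -> dels e b = (e == b)%:R.
    elim: b {sb} => [|y b IHb] [|x e] //= [se].
    by rewrite dels_gt_size /= ?se // mulr0 add0r IHb // eqseq_cons -natrM mulnb.
  move/eqP in sb; rewrite (bigD1 (Tuple sb)) //= [X in _ + X]big1 ?addr0.
    by rewrite dels_id // eqxx mulr1.
  move=> e /negPf eb; rewrite dels_id ?size_tuple ?(eqP sb) //.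
  by rewrite -[_ == b]/(e == Tuple sb) eb mulr0.
rewrite iterS.
rewrite (@eq_del _ (fun v => i`!%:R * \sum_(e : k.-tuple T) c e * dels e v)); last first.
  by move=> u su; rewrite IH ?(ltnW ik) // su sb; lia.
rewrite (delZ o _ (fun v => \sum_(e : k.-tuple T) c e * dels e v)) del_sum.
rewrite factS natrM !mulr_sumr; apply: eq_bigr => e _.
have -> : i.+1%:R = k%:R - (size b)%:R :> R by rewrite -natrB sb; [congr _%:R; lia|lia].
by rewrite del_dels size_tuple; ring.
Qed.

(** A sum over all words shorter than [L] (see [bsumE]), defined by recursion on the first letter so
    that it unfolds together with [dels]. *)
Fixpoint bsum L (F : seq T -> R) : R :=
  if L is L'.+1 then F [::] + \sum_x bsum L' (fun b => F (x :: b)) else 0.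

Lemma bsumE L F : bsum L F = \sum_(l < L) \sum_(b : l.-tuple T) F b.
Proof.
elim: L F => [|L IH] F; first by rewrite big_ord0.
rewrite big_ord_recl (big_tuple0 F) /=; congr (_ + _).
under eq_bigr do rewrite IH.
by rewrite exchange_big; apply: eq_bigr => l _; rewrite (big_tupleS _ F).
Qed.

Lemma eq_bsum L F G : F =1 G -> bsum L F = bsum L G.
Proof. by move=> /funext ->. Qed.

Lemma bsumD L F G : bsum L (fun b => F b + G b) = bsum L F + bsum L G.
Proof. by rewrite !bsumE -big_split; apply: eq_bigr => l _; rewrite -big_split. Qed.

Lemma bsum_small L F : (forall b, (size b >= L)%N -> F b = 0) -> bsum L.+1 F = bsum L F.
Proof.
move=> F0; rewrite !bsumE big_ord_recr /= [X in _ + X]big1 ?addr0 // => b _.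
by rewrite F0 // size_tuple.
Qed.

(** Counts the pairs of ways to delete letters [o] from [e] and from [e'] that leave the same word.
    The bound [L] only keeps the sum finite: by [cdels_cut] it is immaterial once it exceeds the
    length of [e]. *)
Definition cdels L e e' := bsum L (fun b => dels e b * dels e' b).

Lemma cdelsC L e e' : cdels L e e' = cdels L e' e.
Proof. by apply: eq_bsum => b; rewrite mulrC. Qed.

Lemma cdels_cut L e e' : (size e < L)%N -> cdels L.+1 e e' = cdels L e e'.
Proof.
by move=> eL; apply: bsum_small => b Lb; rewrite dels_gt_size ?mul0r // (leq_trans eL).
Qed.

Lemma bsum_delta L (x : T) F : \sum_y bsum L (fun b => (x == y)%:R * F y b) = bsum L (F x).
Proof.
rewrite (bigD1 x) //= [X in _ + X]big1 ?addr0 => [|y /negPf xy].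
  by apply: eq_bsum => b; rewrite eqxx mul1r.
rewrite bsumE big1 // => l _; rewrite big1 // => b _.
by rewrite eq_sym xy mul0r.
Qed.

Lemma bsum0 L : bsum L (fun=> 0) = 0.
Proof. by rewrite bsumE big1 // => l _; rewrite big1. Qed.

(** The common word begins with the undeletable [x], so the leading [o] of the other word must be
    deleted. *)
Lemma cdels_neq L x e e' : x != o ->
  cdels L (x :: e) (o :: e') = cdels L (x :: e) e'.
Proof.
move=> /negPf xo; case: L => [//|L]; rewrite /cdels /= xo !(mul0r, add0r).
apply: eq_bigr => y _; apply: eq_bsum => b; rewrite eqxx mul0r add0r mul1r.
case: (eqVneq x y) => [<-|_]; last by rewrite !mul0r.
by rewrite eq_sym xo mul0r addr0.
Qed.

Lemma cdels_nz L x y e e' : x != o -> y != o -> (size e < L)%N ->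
  cdels L.+1 (x :: e) (y :: e') = (x == y)%:R * cdels L.+1 e e'.
Proof.
move=> /negPf xo /negPf yo eL; rewrite (cdels_cut e' eL) /cdels /= xo yo.
rewrite !(mul0r, add0r).
transitivity (\sum_z bsum L (fun b => (x == z)%:R * ((y == z)%:R * (dels e b * dels e' b)))).
  by apply: eq_bigr => z _; apply: eq_bsum => b; rewrite !mul0r !add0r; ring.
rewrite (bsum_delta L x (fun z b => (y == z)%:R * (dels e b * dels e' b))).
case: (eqVneq x y) => _; first by rewrite mul1r; apply: eq_bsum => b; rewrite mul1r.
by rewrite mul0r (eq_bsum _ (G := fun=> 0)) ?bsum0 // => b; rewrite mul0r.
Qed.

(** Split according to which leading letters [o] are deleted. The two terms on the right count the
    case where both are deleted twice; the surplus equals the case where both are kept, since each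
    of these cases leaves the pair [e], [e']. *)
Lemma cdels_oo L e e' : (size e < L)%N -> cdels L.+1 (o :: e) (o :: e') =
  cdels L.+1 e (o :: e') + cdels L.+1 (o :: e) e'.
Proof.
move=> eL; set F := dels e; set G := dels e'.
pose S F G := \sum_z bsum L (fun b => F (z :: b) * G (z :: b) : R).
have E1 : cdels L.+1 e (o :: e') = F [::] * G [::] + S F G
    + bsum L (fun b => F (o :: b) * G b).
  rewrite /cdels /= eqxx mul1r -/F -/G.
  rewrite -(bsum_delta L o (fun z b => F (z :: b) * G b)) -addrA -big_split /=.
  congr (_ + _); first by rewrite addr0.
  by apply: eq_bigr => z _; rewrite -bsumD; apply: eq_bsum => b; ring.
have E2 : cdels L.+1 (o :: e) e' = F [::] * G [::] + S F G
    + bsum L (fun b => F b * G (o :: b)).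
  rewrite /cdels /= eqxx mul1r -/F -/G.
  rewrite -(bsum_delta L o (fun z b => F b * G (z :: b))) -addrA -big_split /=.
  congr (_ + _); first by rewrite addr0.
  by apply: eq_bigr => z _; rewrite -bsumD; apply: eq_bsum => b; ring.
have E3 : bsum L (fun b => F b * G b) = F [::] * G [::] + S F G.
  by rewrite -[LHS]cdels_cut.
rewrite E1 E2 {1}/cdels /= eqxx !mul1r -/F -/G.
transitivity (F [::] * G [::] + S F G + bsum L (fun b => F (o :: b) * G b)
    + bsum L (fun b => F b * G (o :: b)) + bsum L (fun b => F b * G b)).
  rewrite -(bsum_delta L o (fun z b => F (z :: b) * G b)).
  rewrite -(bsum_delta L o (fun z b => F b * G (z :: b))).
  rewrite -(bsum_delta L o (fun z b => F b * G b)).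
  rewrite -!addrA -!big_split /=.
  congr (_ + _); first by rewrite !addr0.
  apply: eq_bigr => z _; rewrite -!bsumD; apply: eq_bsum => b.
  by rewrite !mul1r; case: (o == z) => /=; ring.
by rewrite E3; ring.
Qed.

Lemma cdels_nil L e : cdels L.+1 e [::] = dels e [::].
Proof.
rewrite /cdels /= mulr1 [X in _ + X]big1 ?addr0 // => x _.
by rewrite (eq_bsum _ (G := fun=> 0)) ?bsum0 // => b; rewrite mulr0.
Qed.

(* Conditioning on the first letter of the random word: each of [e] and [e'] may
   use it or not; by orthonormality a letter other than [o] used by one of them
   must be used by both. *)
Definition shr (B : seq T -> seq T -> R) e e' : R :=
  (if e is x :: e1 then (x == o)%:R * B e1 e' else 0) +
  (if e' is y :: e1' then (y == o)%:R * B e e1' else 0) +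
  match e, e' with
  | x :: e1, y :: e1' => (x == y)%:R * B e1 e1'
  | _, _ => 0
  end.

(* The number of ways to cover [i] positions by an occurrence of [e] and one of
   [e'] sharing the positions of their letters other than [o]. *)
Definition ovl i := iter i shr (fun e e' => (nilp e && nilp e')%:R).

Fixpoint nz v : nat := if v is x :: v' then (x != o) + nz v' else 0.

Lemma size_nz v : size v = (nz v + count_mem o v)%N.
Proof. by elim: v => //= x v ->; case: (x == o); rewrite /=; lia. Qed.


Lemma ovlS i e e' : ovl i.+1 e e' = shr (ovl i) e e'.
Proof. by []. Qed.

(* [size e + size e' - nz e] is the largest number of positions covered by
   occurrences of [e] and [e'] which share the positions of their letters other
   than [o]. *)
Lemma ovl_top i e e' L : (size e < L)%N ->
  ((size e + size e' < i + nz e)%N -> ovl i e e' = 0) /\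
  ((size e + size e' = i + nz e)%N -> ovl i e e' = cdels L.+1 e e').
Proof.
have nzs (u : seq T) : (nz u <= size u)%N by rewrite size_nz leq_addr.
elim: i e e' => [|i IH] e e' eL.
  have := nzs e; rewrite /ovl /= => nze; split => [|se]; first by lia.
  have se'0 : size e' = 0%N by lia.
  rewrite (size0nil se'0) cdels_nil andbT; case: e {eL} nze se => [|x e] //=.
  case: eqVneq => _ /= _ se; last by rewrite mul0r addr0.
  by exfalso; have := nzs e; lia.
have {}IH1 u u' : (size u < L)%N -> (size u + size u' < i + nz u)%N -> ovl i u u' = 0.
  by move=> /(IH u u')[].
have {}IH2 u u' : (size u < L)%N -> (size u + size u' = i + nz u)%N ->
    ovl i u u' = cdels L.+1 u u'.
  by move=> /(IH u u')[].
rewrite ovlS /shr; case: e eL => [|x e] eL; case: e' => [|y e'] /=.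
- by rewrite !addr0; split; [| lia].
- have [->|yo] := eqVneq y o.
    rewrite !(add0r, addr0) mul1r; split => H; first by rewrite IH1 //= ; lia.
    rewrite IH2 //=; last by lia.
    rewrite [LHS]cdelsC [RHS]cdelsC !cdels_nil /= eqxx.
    by rewrite mul1r addr0.
  rewrite mul0r !addr0; split => // H.
  by rewrite cdelsC cdels_nil /= (negPf yo) mul0r addr0.
- rewrite /= in eL; have [->|xo] := eqVneq x o; rewrite !(add0r, addr0).
    rewrite mul1r; split => H; first by rewrite IH1 //=; lia.
    rewrite IH2 //=; try lia.
    by rewrite !cdels_nil /= eqxx mul1r addr0.
  rewrite mul0r; split => // H.
  by rewrite cdels_nil /= (negPf xo) mul0r addr0.
- rewrite /= in eL; have [->|xo] := eqVneq x o; have [->|yo] := eqVneq y o.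
  + rewrite ?eqxx !mul1r /=; split => H; first by rewrite !IH1 ?addr0 //= ?eqxx; lia.
    rewrite cdels_oo; last by lia.
    (* Two letters [o] sharing a position lose one covered position, so the third term of [shr] lies
       beyond the top index; the other two match [cdels_oo]. *)
    rewrite (IH1 e e') ?addr0; [|lia|lia].
    by rewrite !IH2 //= ?eqxx /=; lia.
  + rewrite !mul0r !addr0 mul1r.
    split => H; first by rewrite IH1 //=; lia.
    rewrite IH2 //=; try lia.
    by rewrite cdelsC [RHS]cdelsC cdels_neq.
  + rewrite (negPf xo) !mul0r addr0 add0r mul1r.
    split => H; first by rewrite IH1 //= ?(negPf xo) /=; lia.
    by rewrite IH2 //= ?(negPf xo) /= ?cdels_neq //; lia.
  + rewrite !mul0r !add0r; split => H; first by rewrite IH1 ?mulr0 //; lia.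
    rewrite cdels_nz //; last by lia.
    by rewrite IH2 //; lia.
Qed.

End Shuffle.

(** * The bilinear form of overlap counts and its top index *)

Section Form.
Variables (R : realFieldType) (T : finType) (o : T).
Implicit Types (c d : seq T -> R) (v e b : seq T).

Definition ovl_form k i c d : R :=
  \sum_(e : k.-tuple T) \sum_(e' : k.-tuple T) c e * d e' * ovl R o i e e'.

Lemma nz_hom r N c e : hom o r N c -> c e != 0 -> nz o e = r.
Proof. by move=> hc /hc[ce]; rewrite (size_nz o) ce; lia. Qed.

Lemma ovl_form_gt r N i c d : hom o r N c -> (r + 2 * N < i)%N ->
  ovl_form (r + N) i c d = 0.
Proof.
move=> hc lt_i; rewrite /ovl_form big1 // => e _; rewrite big1 // => e' _.
have [->|ce] := eqVneq (c e) 0; first by rewrite !mul0r.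
have [H _] := @ovl_top R T o i e e' _ (ltnSn (size e)).
by rewrite H ?mulr0 // (nz_hom hc ce) !size_tuple; lia.
Qed.

(** Sorting the pairs by the common word [b] that remains after deletion factors the double sum; by
    [iter_del_dels] the factors are the coordinates at [b] of iterated deletions of [c] and [d]. *)
Lemma ovl_form_top r N c d : hom o r N c ->
  ovl_form (r + N) (r + 2 * N) c d =
  \sum_(i < (r + N).+1)
     (i`!%:R ^- 2) * ip (r + N - i) (iter i (del o) c) (iter i (del o) d).
Proof.
move=> hc; set k := (r + N)%N.
transitivity (\sum_(e : k.-tuple T) \sum_(e' : k.-tuple T)
    c e * d e' * cdels R o k.+1 e e').
  apply: eq_bigr => e _; apply: eq_bigr => e' _.
  have [->|ce] := eqVneq (c e) 0; first by rewrite !mul0r.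
  have ek : (size e < k.+1)%N by rewrite size_tuple.
  have [_ H] := @ovl_top R T o (r + 2 * N) e e' _ ek.
  rewrite H; first by rewrite cdels_cut // size_tuple.
  by rewrite (nz_hom hc ce) !size_tuple /k; lia.
transitivity (\sum_(l < k.+1) \sum_(b : l.-tuple T)
   (\sum_(e : k.-tuple T) c e * dels R o e b) *
   (\sum_(e : k.-tuple T) d e * dels R o e b)).
  under eq_bigr => e _ do under eq_bigr => e' _ do rewrite /cdels bsumE mulr_sumr.
  under eq_bigr => e _ do rewrite exchange_big /=.
  rewrite exchange_big; apply: eq_bigr => l _ /=.
  under eq_bigr => e _ do under eq_bigr => e' _ do rewrite mulr_sumr.
  under eq_bigr => e _ do rewrite exchange_big /=.
  rewrite exchange_big; apply: eq_bigr => b _ /=.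
  rewrite mulr_suml; apply: eq_bigr => e _; rewrite mulr_sumr.
  by apply: eq_bigr => e' _; ring.
(* A common word of length [k - i] remains after [i] deletions. *)
rewrite (reindex_inj rev_ord_inj); apply: eq_bigr => i _ /=.
rewrite subSS /ip mulr_sumr; apply: eq_bigr => b _.
have ik : (i <= k)%N by rewrite -ltnS.
rewrite !(@iter_del_dels R T o _ k) ?size_tuple // -/k.
by field; rewrite pnatr_eq0 -lt0n fact_gt0.
Qed.

End Form.

(** * Occurrences and their correlations *)

Section Count.
Variables (R : realFieldType) (S : finType).

Section Weighted.
Variables (T : finType) (q : T -> S -> R).

(* Occurrences of [e] in [w], each weighted by the product of the [q e_i w_(t_i)]. *)
Fixpoint wocc (w : seq S) (e : seq T) : R :=
  if e is x :: e' then
    if w is y :: w' then q x y * wocc w' e' + wocc w' e else 0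
  else 1.

Fixpoint wprod (e : seq T) (u : seq S) : R :=
  match e, u with
  | x :: e', y :: u' => q x y * wprod e' u'
  | [::], [::] => 1
  | _, _ => 0
  end.

End Weighted.

Let qeq (x y : S) : R := (x == y)%:R.

(** Expands a word by multilinearity: [wprod q e u] is the coefficient of [u] in [e], and with the
    weight [qeq] the function [wocc] counts plain occurrences. *)
Lemma wocc_wprod (T : finType) (q : T -> S -> R) k (e : seq T) (w : seq S) : size e = k ->
  \sum_(u : k.-tuple S) wprod q e u * wocc qeq w u = wocc q w e.
Proof.
elim: w k e => [|y w IH] [|k] [|x e] //= se.
- by rewrite (big_tuple0 (fun u => wprod q [::] u * wocc qeq [::] u)) /= mul1r.
- rewrite (big_tupleS _ (fun u => wprod q (x :: e) u * wocc qeq [::] u)) /=.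
  by rewrite big1 // => z _; rewrite big1 // => u _; rewrite mulr0.
- by rewrite (big_tuple0 (fun u => wprod q [::] u * wocc qeq (y :: w) u)) /= mul1r.
rewrite (big_tupleS _ (fun u => wprod q (x :: e) u * wocc qeq (y :: w) u)) /=.
case: se => se; rewrite -(IH _ _ se) -(IH k.+1 (x :: e)) /= ?se //.
rewrite (big_tupleS _ (fun u => wprod q (x :: e) u * wocc qeq w u)) /=.
under eq_bigr => z _ do under eq_bigr => u _ do rewrite mulrDr.
under eq_bigr => z _ do rewrite big_split /=.
rewrite big_split /=; congr (_ + _).
rewrite (bigD1 y) //= [X in _ + X]big1 ?addr0.
  by rewrite mulr_sumr; apply: eq_bigr => u _; rewrite /qeq eqxx mul1r mulrA.
by move=> z /negPf zy; rewrite big1 // => u _; rewrite /qeq zy mul0r mulr0.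
Qed.

Lemma sum_ord_from n m (F : nat -> R) : (m < n)%N ->
  \sum_(i < n | (m <= i)%N) F i = F m + \sum_(i < n | (m < i)%N) F i.
Proof.
move=> mn; rewrite (bigD1 (Ordinal mn)) //=; congr (_ + _).
by apply: eq_bigl => i; rewrite [RHS]ltn_neqAle andbC eq_sym.
Qed.

(** The lower bound [m] on the positions makes the induction on [u] possible: once the first
    position [i] is chosen, the others are at least [i + 1], that is, they lie in the suffix
    [drop i.+1 w]. *)
Lemma wocc_path n (w : n.-tuple S) k (u : seq S) m : size u = k -> (m <= n)%N ->
  \sum_(t : k.-tuple 'I_n | sorted ltn (map val t) && all (leq m) (map val t))
     (map (tnth w) t == u)%:R = wocc qeq (drop m w) u.
Proof.
elim: u k m => [|x u IH] [|k] m // su mn.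
  rewrite big_mkcond /= (big_tuple0 (fun t : seq 'I_n =>
     if sorted ltn (map val t) && all (leq m) (map val t)
     then (map (tnth w) t == [::])%:R else 0)) /=.
  by case: drop.
case: su => su.
have step m' : (m' <= n)%N -> 
  \sum_(t : k.+1.-tuple 'I_n | sorted ltn (map val t) && all (leq m') (map val t))
     (map (tnth w) t == x :: u)%:R =
  \sum_(i < n | (m' <= i)%N) qeq x (tnth w i) * wocc qeq (drop i.+1 w) u.
  move=> m'n; rewrite big_mkcond /= (big_tupleS _ (fun t : seq 'I_n =>
     if sorted ltn (map val t) && all (leq m') (map val t)
     then (map (tnth w) t == x :: u)%:R else 0)) /=.
  rewrite [RHS]big_mkcond; apply: eq_bigr => i _ /=.
  rewrite -(IH _ _ su (ltn_ord i)).
  case: ifP => m'i; last by rewrite big1 // => t _; rewrite andbF.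
  rewrite [X in _ * X]big_mkcond mulr_sumr; apply: eq_bigr => t _ /=.
  have allE : path ltn i (map val t) && all (leq m') (map val t) =
      sorted ltn (map val t) && all (leq i.+1) (map val t).
    rewrite path_sortedE; last exact: ltn_trans.
    case: (sorted _ _); rewrite ?andbF //= ?andbT.
    case: (boolP (all _ _)) => //= /allP a; apply/allP => j /a ij.
    by rewrite (leq_trans m'i) // ltnW.
  by rewrite allE; case: ifP; rewrite ?mulr0 // eqseq_cons -natrM mulnb eq_sym.
(* Downward induction on [m], carried out on [n - m]: the recursion of [wocc] either uses the
   position [m] or skips it. *)
rewrite step // {step} -(subKn mn).
elim: (n - m)%N (leq_subr m n) => [|j IHj] jn.
  rewrite subn0 drop_oversize ?size_tuple // big_pred0 // => i.
  by rewrite leqNgt ltn_ord.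
have lt_n : (n - j.+1 < n)%N by lia.
under eq_bigr => i _ do rewrite (tnth_nth x).
rewrite (sum_ord_from (fun i => qeq x (nth x w i) * wocc qeq (drop i.+1 w) u) lt_n).
rewrite [in RHS](drop_nth x) ?size_tuple // subnSK // /=; congr (_ + _).
rewrite -IHj ?(ltnW jn) //.
by apply: eq_bigr => i _; rewrite (tnth_nth x).
Qed.

Lemma wocc_occ k n (u : k.-tuple S) (w : n.-tuple S) :
  (occ u w)%:R = wocc qeq w u.
Proof.
rewrite -[in RHS](drop0 w) -(wocc_path w (size_tuple u)) //.
rewrite /occ -sum1_card natr_sum big_mkcond [RHS]big_mkcond.
apply: eq_bigr => t _; rewrite inE.
have -> : all (leq 0) (map val t) by apply/allP.
by rewrite andbT -val_eqE /=; case: (sorted _ _) => //=; case: (_ == _).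
Qed.

End Count.

(** * Second moments of weighted occurrence counts *)

Section Expect.
Variables (R : realFieldType) (S T : finType) (o : T).
Variables (p : S -> R) (q : T -> S -> R).
Hypotheses (hsum : \sum_y p y = 1)
  (q1 : forall x, \sum_y p y * q x y = (x == o)%:R)
  (q2 : forall x x', \sum_y p y * q x y * q x' y = (x == x')%:R).

Definition corr n (e e' : seq T) : R :=
  \sum_(w : n.-tuple S) (\prod_(y <- w) p y) * (wocc q w e * wocc q w e').

Lemma wocc_cons y w (e : seq T) : wocc q (y :: w) e =
  wocc q w e + if e is x :: e1 then q x y * wocc q w e1 else 0.
Proof. by case: e => [|x e]; case: w => [|z w] /=; rewrite ?addr0 ?add0r // addrC. Qed.

Lemma corr0 e e' : corr 0 e e' = (nilp e && nilp e')%:R.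
Proof.
rewrite /corr (big_tuple0 (fun w => (\prod_(y <- w) p y) * (wocc q w e * wocc q w e'))).
by rewrite big_nil mul1r; case: e e' => [|x e] [|x' e'] /=; ring.
Qed.

(** In the average over the first letter, the case where neither word uses it is settled by [hsum],
    the case of one by [q1], and the case of both by [q2]. *)
Lemma corrS n e e' : corr n.+1 e e' = corr n e e' + shr o (corr n) e e'.
Proof.
rewrite /corr (big_tupleS _ (fun w => (\prod_(y <- w) p y) * (wocc q w e * wocc q w e'))).
rewrite exchange_big; cbv beta.
pose a0 w u v : R := (\prod_(y <- w) p y) * (wocc q w u * wocc q w v).
transitivity (\sum_(w : n.-tuple S) (a0 w e e' + shr o (a0 w) e e')); last first.
  rewrite big_split /=; congr (_ + _); rewrite /shr !big_split /=; congr (_ + _ + _).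
  - by case: e => [|x e]; [rewrite big1 | rewrite mulr_sumr].
  - by case: e' => [|x e']; [rewrite big1 | rewrite mulr_sumr].
  - by case: e e' => [|x e] [|x' e']; [rewrite big1..|rewrite mulr_sumr].
apply: eq_bigr => w _.
under eq_bigr => y _ do rewrite big_cons !wocc_cons.
rewrite /shr /a0; set P := \prod_(y <- w) p y.
case: e e' => [|x e] [|x' e'].
- under eq_bigr => y _ do rewrite !addr0 -mulrA.
  by rewrite -mulr_suml hsum mul1r !addr0.
- rewrite -(q1 x') !(addr0, add0r) -[X in X + _]mul1r -hsum !mulr_suml -big_split /=.
  by apply: eq_bigr => y _; ring.
- rewrite -(q1 x) !(addr0, add0r) -[X in X + _]mul1r -hsum !mulr_suml -big_split /=.
  by apply: eq_bigr => y _; ring.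
- rewrite -(q1 x) -(q1 x') -q2 -[X in X + _]mul1r -hsum !mulr_suml -!big_split /=.
  by apply: eq_bigr => y _; ring.
Qed.

Lemma shr_sum (I : finType) (a : I -> R) (B : I -> seq T -> seq T -> R) e e' :
  shr o (fun u v => \sum_i a i * B i u v) e e' = \sum_i a i * shr o (B i) e e'.
Proof.
rewrite /shr; under [RHS]eq_bigr do rewrite !mulrDr.
rewrite !big_split /=; congr (_ + _ + _).
- case: e => [|x e]; first by rewrite big1 // => i _; rewrite mulr0.
  by rewrite mulr_sumr; apply: eq_bigr => i _; ring.
- case: e' => [|x e']; first by rewrite big1 // => i _; rewrite mulr0.
  by rewrite mulr_sumr; apply: eq_bigr => i _; ring.
- case: e e' => [|x e] [|x' e']; try by rewrite big1 // => i _; rewrite mulr0.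
  by rewrite mulr_sumr; apply: eq_bigr => i _; ring.
Qed.

(** By [corrS] the sequence [corr n] is [(1 + shr)^n] applied to [corr 0]; this is the binomial
    expansion, proved through Pascal's rule. *)
Lemma corrE n e e' : corr n e e' = \sum_(i < n.+1) 'C(n, i)%:R * ovl R o i e e'.
Proof.
elim: n e e' => [|n IH] e e'.
  by rewrite big_ord1 corr0 bin0 mul1r.
have -> : corr n.+1 e e' = \sum_(i < n.+1) 'C(n, i)%:R * ovl R o i e e' +
     \sum_(i < n.+1) 'C(n, i)%:R * ovl R o i.+1 e e'.
  rewrite corrS IH; congr (_ + _).
  rewrite (_ : corr n = fun u v => \sum_(i < n.+1) 'C(n, i)%:R * ovl R o i u v).
    by rewrite shr_sum.
  by apply/funext => u; apply/funext => v.
rewrite [RHS]big_ord_recl /= big_ord_recl /= -addrA; congr (_ + _).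
  by rewrite !bin0.
transitivity (\sum_(i < n.+1) 'C(n, i.+1)%:R * ovl R o i.+1 e e'
  + \sum_(i < n.+1) 'C(n, i)%:R * ovl R o i.+1 e e').
  congr (_ + _); rewrite big_ord_recr /= bin_small // mul0r addr0.
  by apply: eq_bigr.
by rewrite -big_split; apply: eq_bigr => i _; rewrite /= binS natrD mulrDl.
Qed.

Lemma sum_corr k n (c d : seq T -> R) :
  \sum_(w : n.-tuple S) (\prod_(y <- w) p y) *
    ((\sum_(e : k.-tuple T) c e * wocc q w e) *
     (\sum_(e : k.-tuple T) d e * wocc q w e)) =
  \sum_(i < n.+1) 'C(n, i)%:R * ovl_form o k i c d.
Proof.
transitivity (\sum_(e : k.-tuple T) \sum_(e' : k.-tuple T) c e * d e' * corr n e e').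
  under [RHS]eq_bigr => e _ do under eq_bigr => e' _ do rewrite /corr mulr_sumr.
  under [RHS]eq_bigr => e _ do rewrite exchange_big /=.
  rewrite [RHS]exchange_big; apply: eq_bigr => w _ /=.
  rewrite mulr_suml mulr_sumr; apply: eq_bigr => e _.
  by rewrite !mulr_sumr; apply: eq_bigr => e' _; ring.
under eq_bigr => e _ do under eq_bigr => e' _ do rewrite corrE mulr_sumr.
under eq_bigr => e _ do rewrite exchange_big /=.
rewrite exchange_big; apply: eq_bigr => i _ /=.
rewrite /ovl_form mulr_sumr; apply: eq_bigr => e _.
by rewrite mulr_sumr; apply: eq_bigr => e' _; ring.
Qed.

End Expect.

(** * Coordinates on the words over the orthonormal letters *)

Section Coord.
Variables (R : realType) (S : finType) (p : S -> R).
Variables (D : 'I_#|S| -> Wspace R S 1) (o : 'I_#|S|).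
Hypothesis hsum : \sum_y p y = 1.
Hypotheses (hD : orthonormal_basis1 p D) (ho : val o = 0%N).

Local Notation T := 'I_#|S|.
Let q (x : T) (y : S) : R := D x [tuple y].

Lemma val_eqo (x : T) : (val x == 0%N) = (x == o).
Proof. by rewrite -val_eqE ho. Qed.

Lemma letter_orthonormal x x' : \sum_y p y * q x y * q x' y = (x == x')%:R.
Proof.
case: hD => _ <- _; rewrite /inner.
transitivity (\sum_y \sum_(v : 0.-tuple S) p y * q x y * q x' y).
  apply: eq_bigr => y _.
  by rewrite (big_tuple0 (fun=> p y * q x y * q x' y)).
rewrite pair_big /= (reindex (fun t : 1.-tuple S => (thead t, [tuple of behead t]))) /=.
  apply: eq_bigr => t _; rewrite /wordp big_ord1.
  have -> : t = [tuple thead t] :> 1.-tuple S.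
    by rewrite {1}[t]tuple_eta; case: t => -[|a [|]] //= ?; apply: val_inj.
  by rewrite /q /thead !(tnth_nth (thead t)).
exists (fun r : S * 0.-tuple S => [tuple of r.1 :: r.2]) => [t _|[y v] _] /=.
  by rewrite [RHS]tuple_eta.
by congr pair; apply: val_inj.
Qed.

Lemma letter1 y : q o y = 1.
Proof. by case: hD => D0 _ _; rewrite /q D0 // ffunE. Qed.

(** The mean of a letter is its inner product with the constant letter [o]. *)
Lemma letter_mean x : \sum_y p y * q x y = (x == o)%:R.
Proof.
rewrite -letter_orthonormal; apply: eq_bigr => y _.
by rewrite letter1 mulr1.
Qed.

(* A one-sided inverse of a square matrix is two-sided. *)
Lemma letter_complete y y' : \sum_x q x y * q x y' * p y = (y == y')%:R.
Proof.
pose A : 'M[R]_#|S| := \matrix_(i, j) q i (enum_val j).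
pose B : 'M[R]_#|S| := \matrix_(i, j) (p (enum_val i) * q j (enum_val i)).
have AB : A *m B = 1%:M.
  apply/matrixP => i j; rewrite !mxE -(letter_orthonormal i j).
  rewrite [RHS](reindex_onto enum_val enum_rank) /=; last by move=> z _; exact: enum_rankK.
  by apply: eq_big => [z|z _]; rewrite ?enum_valK ?eqxx // !mxE; ring.
move/mulmx1C/matrixP/(_ (enum_rank y) (enum_rank y')): AB.
rewrite !mxE (inj_eq enum_rank_inj) => <-.
by apply: eq_bigr => x _; rewrite !mxE !enum_rankK; ring.
Qed.

Lemma concatE k (e : k.-tuple T) (u : k.-tuple S) : concat D e u = wprod q e u.
Proof.
rewrite /concat ffunE.
elim: k e u => [|k IH] e u; first by rewrite big_ord0 [e]tuple0 [u]tuple0.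
case/tupleP: e => x e; case/tupleP: u => y u.
rewrite big_ord_recl /= !tnth0 -IH; congr (_ * _).
by apply: eq_bigr => i _; rewrite !tnthS.
Qed.

(** Completeness passes from letters to words factor by factor; it is what lets every vector be
    expanded in [coord_expand]. *)
Lemma wprod_complete k (u u' : k.-tuple S) :
  \sum_(e : k.-tuple T) wprod q e u * wprod q e u' * \prod_(y <- u) p y = (u == u')%:R.
Proof.
elim: k u u' => [|k IH] u u'.
  rewrite (big_tuple0 (fun e => wprod q e u * wprod q e u' * \prod_(y <- u) p y)).
  by rewrite [u]tuple0 [u']tuple0 /= big_nil !mulr1.
case/tupleP: u => y u; case/tupleP: u' => y' u'.
rewrite (big_tupleS _ (fun e => wprod q e [tuple of y :: u] * wprod q e [tuple of y' :: u'] *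
   \prod_(y <- [tuple of y :: u]) p y)) /= big_cons.
rewrite -val_eqE /= eqseq_cons -mulnb natrM -letter_complete.
have -> : (val u == val u') = (u == u') by [].
rewrite -IH mulr_suml; apply: eq_bigr => x _.
by rewrite mulr_sumr; apply: eq_bigr => e _; ring.
Qed.

Lemma wordpE k (u : k.-tuple S) : wordp p u = \prod_(y <- u) p y.
Proof. by rewrite /wordp big_tuple. Qed.

(* Coordinates of words of length other than [k] are [0]. *)
Definition dcoord k (f : Wspace R S k) (v : seq T) : R :=
  \sum_(e : k.-tuple T | val e == v) inner p f (concat D e).

Lemma coord_tuple k (f : Wspace R S k) (e : k.-tuple T) :
  dcoord f e = inner p f (concat D e).
Proof. by rewrite /dcoord (big_pred1 e). Qed.

Lemma coord_size k (f : Wspace R S k) v : dcoord f v != 0 -> size v = k.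
Proof.
have [//|sv] := eqVneq (size v) k; rewrite /dcoord big_pred0 ?eqxx // => e.
by apply: contraNF sv => /eqP <-; rewrite size_tuple.
Qed.

Lemma coord_expand k (f : Wspace R S k) u :
  f u = \sum_(e : k.-tuple T) dcoord f e * wprod q e u.
Proof.
transitivity (\sum_u' f u' * (u' == u)%:R).
  rewrite (bigD1 u) //= [X in _ + X]big1 ?addr0 => [|u' /negPf ->].
    by rewrite eqxx mulr1.
  by rewrite mulr0.
under [RHS]eq_bigr => e _ do rewrite coord_tuple /inner mulr_suml.
rewrite [RHS]exchange_big /=; apply: eq_bigr => u' _.
rewrite -wprod_complete mulr_sumr; apply: eq_bigr => e _.
by rewrite concatE wordpE; ring.
Qed.

Lemma coord_eq0 k (f : Wspace R S k) : dcoord f = (fun=> 0) -> f = 0.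
Proof.
move=> f0; apply/ffunP => u; rewrite coord_expand f0 ffunE.
by rewrite big1 // => e _; rewrite mul0r.
Qed.

Lemma inner_sum (I : finType) (P : pred I) k (g : Wspace R S k) (a : I -> R)
    (F : I -> Wspace R S k) :
  inner p (\sum_(i | P i) a i *: F i) g = \sum_(i | P i) a i * inner p (F i) g.
Proof.
rewrite /inner; under [RHS]eq_bigr do rewrite mulr_sumr.
rewrite [RHS]exchange_big; apply: eq_bigr => u _ /=.
rewrite sum_ffunE mulr_sumr mulr_suml; apply: eq_bigr => i _.
by rewrite ffunE -[_ *: _]/(_ * _); ring.
Qed.

Lemma coord_comb k (a : k.-tuple T -> R) (e : k.-tuple T) :
  dcoord (\sum_e' a e' *: concat D e') e = a e.
Proof.
rewrite coord_tuple inner_sum (bigD1 e) //= inner_concat // eqxx mulr1.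
rewrite big1 ?addr0 // => e' /negPf ee'.
by rewrite inner_concat // ee' mulr0.
Qed.

Lemma comb_coord k (f : Wspace R S k) :
  f = \sum_(e : k.-tuple T) dcoord f e *: concat D e.
Proof.
apply/ffunP => u; rewrite coord_expand sum_ffunE; apply: eq_bigr => e _.
by rewrite ffunE concatE.
Qed.

Lemma coord0 k : dcoord (0 : Wspace R S k) = (fun=> 0).
Proof.
apply/funext => v; rewrite /dcoord big1 // => e _.
by rewrite /inner big1 // => u _; rewrite ffunE mulr0 mul0r.
Qed.

Lemma inner_ip k (f g : Wspace R S k) : inner p f g = ip k (dcoord f) (dcoord g).
Proof.
rewrite {1}(comb_coord f) inner_sum; apply: eq_bigr => e _; congr (_ * _).
by rewrite coord_tuple; apply: eq_bigr => u _; ring.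
Qed.

Lemma count_letters k (e : k.-tuple T) :
  #|[set i : 'I_k | val (tnth e i) == 0%N]| = count_mem o e.
Proof.
rewrite -sum1_card -sum1_count big_tuple.
by apply: eq_big => i //; rewrite inE val_eqo.
Qed.

(** By orthonormality a vector of the span has zero coordinates outside the spanning words;
    conversely, its expansion uses only words of its support. *)
Lemma Wkr_coord k r (f : Wspace R S k) : (r <= k)%N ->
  f \in Wkr D k r <-> hom o r (k - r) (dcoord f).
Proof.
move=> rk; rewrite /Wkr; set X := (X in <<X>>%VS); split => [fW v cv|hf].
  have sv := coord_size cv; rewrite subnKC //; split => //.
  move/eqP in sv; apply: contra_neq_eq cv => nv; rewrite -[v]/(val (Tuple sv)).
  rewrite coord_tuple (coord_span (X := in_tuple X) fW) inner_sum big1 // => i _.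
  have /fintype.imageP[e + ->] := mem_nth 0 (ltn_ord i : (i < size X)%N).
  rewrite inE count_letters inner_concat // => /eqP ce.
  case: eqVneq => [ev|_]; last by rewrite mulr0.
  by rewrite -ce ev eqxx in nv.
rewrite (comb_coord f); apply: memv_suml => e _.
have [->|ce] := eqVneq (dcoord f e) 0; first by rewrite scale0r mem0v.
apply/memvZ/memv_span/fintype.imageP; exists e => //.
by rewrite inE count_letters; have [-> _] := hf _ ce.
Qed.

Lemma delete_at0 (x : T) k (e : k.-tuple T) : delete_at ord0 [tuple of x :: e] = e.
Proof. by apply: eq_from_tnth => i; rewrite tnth_mktuple tnthS. Qed.

Lemma delete_atS (x : T) k (e : k.-tuple T) (i : 'I_k) :
  delete_at (lift ord0 i) [tuple of x :: e] = x :: delete_at i e :> seq T.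
Proof.
case: k e i => [|k] e i; first by case: i.
suff -> : delete_at (lift ord0 i) [tuple of x :: e] = [tuple of x :: delete_at i e] by [].
apply: eq_from_tnth => j; rewrite tnth_mktuple.
case: (unliftP ord0 j) => [j' ->|->].
  rewrite tnthS tnth_mktuple (_ : lift _ _ = lift ord0 (lift i j')) ?tnthS //.
  by apply: val_inj; rewrite /= /bump /=; lia.
rewrite (_ : lift _ _ = ord0) ?tnth0 //.
by apply: val_inj; rewrite /= /bump.
Qed.

Lemma ins_delete_at k (c : seq T -> R) (e : k.-tuple T) :
  ins o c e = \sum_(i < k | val (tnth e i) == 0%N) c (delete_at i e).
Proof.
elim: k c e => [|k IH] c e; first by rewrite big_ord0 [e]tuple0.
case/tupleP: e => x e; rewrite big_mkcond big_ord_recl tnth0 val_eqo delete_at0 /=.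
congr (_ + _); first by case: eqP => _; rewrite ?mul0r ?mul1r.
rewrite IH big_mkcond; apply: eq_bigr => i _ /=.
by rewrite tnthS -delete_atS.
Qed.

(** The deletion of a basis word is read off by [ins] (see [ins_delete_at]); pairing with the
    indicator of [v] and applying [ip_del] turns it into [del]. *)
Lemma coord_deletion k (f : Wspace R S k) :
  dcoord (deletion p D f) = del o (dcoord f).
Proof.
case: k f => [|k] f; apply/funext => v.
  (* For [k = 0] the target length [k.-1] is again [0]: the empty word has no letter to delete, and
     an insertion would need a word of positive length. *)
  rewrite /deletion big1 => [|e _]; last by rewrite /deletion_word big_ord0 scaler0.
  rewrite coord0; apply/esym/eqP/contraT => /del_neq0[b /coord_size sb [_]].
  by rewrite sb.
have [sv|sv] := eqVneq (size v) k; last first.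
  apply/eqP; case: eqVneq => // H; exfalso; move: H sv.
  have [->|/coord_size /= ->] := eqVneq (dcoord (deletion p D f) v) 0; last by rewrite eqxx.
  by rewrite eq_sym => /del_neq0[b /coord_size sb [_]]; rewrite sb => -[->]; rewrite eqxx.
move/eqP in sv; rewrite -[v]/(val (Tuple sv)); set t := Tuple sv.
rewrite (@coord_tuple k) /deletion inner_sum /deletion_word.
pose dt (u : seq T) : R := (u == t)%:R.
transitivity (ip k (del o (dcoord f)) dt); last first.
  rewrite /ip (bigD1 t) //= [X in _ + X]big1 ?addr0 => [|u ut].
    by rewrite /dt eqxx mulr1.
  by rewrite /dt val_eqE (negPf ut) mulr0.
rewrite ip_del; apply: eq_bigr => e _; rewrite -coord_tuple ins_delete_at.
congr (_ * _); under eq_bigr => i _ do rewrite -[concat _ _]scale1r.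
rewrite inner_sum; apply: eq_bigr => i _.
by rewrite mul1r inner_concat // /dt -val_eqE.
Qed.

Lemma coord_deletion_iter k j (f : Wspace R S k) :
  dcoord (deletion_iter p D j f) = iter j (del o) (dcoord f).
Proof. by elim: j => [//|j IH] /=; rewrite coord_deletion IH. Qed.

Lemma densityW_coord k n (f : Wspace R S k) (w : n.-tuple S) :
  densityW f w = (\sum_(e : k.-tuple T) dcoord f e * wocc q w e) / 'C(n, k)%:R.
Proof.
rewrite /densityW /density; under eq_bigr do rewrite mulrA.
rewrite -mulr_suml; congr (_ / _).
under eq_bigr => u _ do rewrite coord_expand mulr_suml.
rewrite exchange_big; apply: eq_bigr => e _ /=.
rewrite -(wocc_wprod q w (size_tuple e)) mulr_sumr; apply: eq_bigr => u _.
by rewrite wocc_occ mulrA.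
Qed.

Lemma expect_densityW k n (f f' : Wspace R S k) (a : R) :
  expect_word p (fun w : n.-tuple S => (a * densityW f w) * (a * densityW f' w)) =
  a ^+ 2 / 'C(n, k)%:R ^+ 2 *
  \sum_(i < n.+1) 'C(n, i)%:R * ovl_form o k i (dcoord f) (dcoord f').
Proof.
rewrite -(sum_corr hsum letter_mean letter_orthonormal) /expect_word mulr_sumr.
apply: eq_bigr => w _; rewrite wordpE !densityW_coord -exprVn; ring.
Qed.

Lemma Wkrm_form k r m (f g : Wspace R S k) : (r <= k)%N -> (m <= k - r)%N ->
  Wkrm p D r m f ->
  ovl_form o k (2 * k - r) (dcoord f) (dcoord g) = 'C(2 * k - r, k - r - m)%:R * inner p f g.
Proof.
move=> rk mk [/(Wkr_coord _ rk) hf df of_].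
have [N kE] : exists N, k = (r + N)%N by exists (k - r)%N; rewrite subnKC.
have [M NE] : exists M, N = (m + M)%N by exists (N - m)%N; rewrite subnKC //; lia.
have kr : (k - r = m + M)%N by lia.
have krm : (k - r - m = M)%N by lia.
rewrite krm kr in hf df of_ *.
have -> : (2 * k - r = r + 2 * (m + M))%N by lia.
have dc : iter M.+1 (del o) (dcoord f) = (fun=> 0).
  by rewrite -coord_deletion_iter df coord0.
(* The orthogonality in [Wkrm] ranges over vectors, the one in [sum_ip_iter_del] over coordinate
   functions; [g'] is the vector with coordinates [h]. *)
have orth h : hom o r (m + M) h -> iter M (del o) h = (fun=> 0) -> ip k (dcoord f) h = 0.
  move=> hh dh; pose g' : Wspace R S k := \sum_(e : k.-tuple T) h e *: concat D e.
  have g'E : dcoord g' = h.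
    apply/funext => v.
    have [sv|sv] := eqVneq (size v) k.
      by move/eqP in sv; rewrite -[v]/(val (Tuple sv)) coord_comb.
    have [->|/coord_size] := eqVneq (dcoord g' v) 0; last by move/eqP; rewrite (negPf sv).
    by apply/esym/eqP; apply: contraNT sv => /hh[_ ->]; lia.
  rewrite -g'E -inner_ip; apply: of_.
    by apply/(Wkr_coord _ rk); rewrite g'E kr.
  by apply: coord_eq0; rewrite coord_deletion_iter g'E.
rewrite inner_ip; move: (dcoord f) (dcoord g) hf dc orth => c d.
have -> : k = (r + (m + M))%N by lia.
by move=> hc dc orth; rewrite (ovl_form_top _ hc) (sum_ip_iter_del _ hc dc orth).
Qed.

End Coord.

Local Open Scope classical_set_scope.
Local Open Scope ring_scope.

(** * The limit *)

Section Limit.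
Variable R : realType.

Lemma cvg_natV : (n%:R^-1 : R) @[n --> \oo] --> (0 : R).
Proof. by rewrite -cvg_shiftS; exact: cvg_harmonic. Qed.

(** The ratio of consecutive terms is [(1 - i / n) / (i + 1)]. *)
Lemma cvg_bin i : ('C(n, i)%:R / n%:R ^+ i : R) @[n --> \oo] --> (i`!%:R^-1 : R).
Proof.
elim: i => [|i IH].
  have -> : (fun n => 'C(n, 0)%:R / n%:R ^+ 0) = cst (0`!%:R^-1) :> (nat -> R).
    by apply/funext => n; rewrite bin0 expr0 fact0 mul1r.
  exact: cvg_cst.
have -> : (i.+1)`!%:R^-1 = i`!%:R^-1 * ((1 - i%:R * 0) / i.+1%:R) :> R.
  by rewrite mulr0 subr0 factS natrM invfM mul1r mulrC.
have H : ('C(n, i)%:R / n%:R ^+ i * ((1 - i%:R * n%:R^-1) / i.+1%:R)) @[n --> \oo] -->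
    (i`!%:R^-1 * ((1 - i%:R * 0) / i.+1%:R) : R).
  apply: cvgM IH _; apply: cvgMr_tmp; apply: cvgB; first exact: cvg_cst.
  by apply: cvgMl_tmp; exact: cvg_natV.
apply: cvg_trans H; apply: near_eq_cvg; near=> n => /=.
have n0 : n%:R != 0 :> R by rewrite pnatr_eq0 -lt0n; near: n; exact: nbhs_infty_gt.
have ni : (i <= n)%N by near: n; exact: nbhs_infty_ge.
have : i.+1%:R * 'C(n, i.+1)%:R = (n%:R - i%:R) * 'C(n, i)%:R :> R.
  by rewrite -natrM mul_bin_left natrM natrB.
move=> /(canRL (mulKf _)) -> //; rewrite ?pnatr_eq0 // exprS; field.
by rewrite n0 expf_neq0 // nat1r pnatr_eq0.
Unshelve. all: by end_near. Qed.

(** The [i]-th summand has order [n^(r + i - 2 k)], so in the limit only the top index [i = 2 k - r]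
    survives. *)
Lemma cvg_binomial_sum k r (A : nat -> R) : (r <= k)%N ->
  (forall i, (2 * k - r < i)%N -> A i = 0) ->
  ((n%:R `^ (r%:R / 2)) ^+ 2 / 'C(n, k)%:R ^+ 2 *
    \sum_(i < n.+1) 'C(n, i)%:R * A i) @[n --> \oo] -->
  (k`!%:R ^+ 2 / (2 * k - r)`!%:R * A (2 * k - r)%N : R).
Proof.
move=> rk A0; set L := (2 * k - r)%N.
pose b i (n : nat) : R := 'C(n, i)%:R / n%:R ^+ i.
pose t i n : R := b i n / b k n ^+ 2 * n%:R^-1 ^+ (L - i) * A i.
have cvgt i : t i n @[n --> \oo] --> (i`!%:R^-1 / (k`!%:R^-1) ^+ 2 * 0 ^+ (L - i) * A i).
  apply: cvgMr_tmp; apply: cvgM; last first.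
    by apply: (@cvg_comp _ _ _ _ (fun x => x ^+ (L - i)) _ _ _ cvg_natV); exact: exprn_continuous.
  apply: cvgM; first exact: cvg_bin.
  apply: cvgV; first by rewrite expf_neq0 // invr_eq0 pnatr_eq0 -lt0n fact_gt0.
  rewrite expr2.
  have -> : (fun n => b k n ^+ 2) = b k \* b k by apply/funext => n; rewrite expr2.
  apply: cvgM; exact: cvg_bin.
(* The factor [0 ^+ (L - i)] selects the top index: it is [1] for [i = L] and [0] below. *)
have -> : k`!%:R ^+ 2 / L`!%:R * A L =
    \sum_(i < L.+1) i`!%:R^-1 / (k`!%:R^-1) ^+ 2 * 0 ^+ (L - i) * A i.
  rewrite big_ord_recr /= subnn expr0 mulr1 big1 ?add0r => [|i _].
    by rewrite exprVn invrK [in RHS]mulrC mulrC mulrA [_ * A L]mulrC; ring.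
  by rewrite expr0n subn_eq0 leqNgt ltn_ord /= mulr0 mul0r.
have H : (\sum_(i < L.+1) t i n) @[n --> \oo] -->
    (\sum_(i < L.+1) i`!%:R^-1 / (k`!%:R^-1) ^+ 2 * 0 ^+ (L - i) * A i : R).
  by apply: cvg_big => [|i _]; [exact: add_continuous | exact: cvgt].
apply: cvg_trans H; apply: near_eq_cvg; near=> n.
have n0 : n%:R != 0 :> R by rewrite pnatr_eq0 -lt0n; near: n; exact: nbhs_infty_gt.
(* This makes ['C(n, k)] nonzero and brings every index up to [L] into the range of the sum. *)
have nk : (2 * k <= n)%N by near: n; exact: nbhs_infty_ge.
have -> : (n%:R `^ (r%:R / 2)) ^+ 2 = n%:R ^+ r :> R.
  by rewrite -powR_mulrn ?powR_ge0 // -powRrM divfK // powR_mulrn // ler0n.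
have -> : \sum_(i < n.+1) 'C(n, i)%:R * A i = \sum_(i < L.+1) 'C(n, i)%:R * A i.
  rewrite -!(big_mkord predT (fun i => 'C(n, i)%:R * A i)).
  have -> : (n.+1 = L.+1 + (n - L))%N by rewrite /L; lia.
  rewrite /index_iota !subn0 iotaD big_cat /= [X in _ + X = _]big_seq_cond.
  rewrite [X in _ + X = _]big1 ?addr0 // => i.
  by rewrite andbT mem_iota => /andP[Mi _]; rewrite A0 ?mulr0.
rewrite mulr_sumr; apply: eq_bigr => i _; rewrite /t /b.
have C0 : 'C(n, k)%:R != 0 :> R by rewrite pnatr_eq0 -lt0n bin_gt0; lia.
have iL : (i <= L)%N by rewrite -ltnS.
have -> : n%:R ^+ r = n%:R ^+ k * n%:R ^+ k / (n%:R ^+ i * n%:R ^+ (L - i)) :> R.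
  rewrite -!exprD subnKC // /L.
  have -> : (k + k = r + (2 * k - r))%N by lia.
  by rewrite exprD mulfK // expf_neq0.
rewrite exprVn; field.
by rewrite C0 !expf_neq0.
Unshelve. all: by end_near. Qed.

End Limit.

Theorem theorem2 (R : realType) (Sigma : finType) (p : Sigma -> R)
  (hd : (2 <= #|Sigma|)%N)
  (hp : forall x : Sigma, 0 < p x < 1)
  (hsum : \sum_(x : Sigma) p x = 1)
  (D : 'I_#|Sigma| -> Wspace R Sigma 1)
  (hD : orthonormal_basis1 p D)
  (k r m m' : nat)
  (hr : (1 <= r <= k)%N) (hm : (m <= k - r)%N) (hm' : (m' <= k - r)%N)
  (f f' : Wspace R Sigma k)
  (hf : Wkrm p D r m f) (hf' : Wkrm p D r m' f') :
  let E := fun n : nat => expect_word p (fun w : n.-tuple Sigma =>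
    ((n%:R `^ (r%:R / 2)) * densityW f w) *
    ((n%:R `^ (r%:R / 2)) * densityW f' w)) in
  (E n @[n --> \oo] -->
     (k`!%:R ^+ 2 * inner p f f') / ((k + m)`!%:R * (k - r - m)`!%:R))
  /\ (m' <> m -> inner p f f' = 0 /\ (E n @[n --> \oo] --> inner p f f')).
Proof.
move=> E; have rk : (r <= k)%N by case/andP: hr.
pose o : 'I_#|Sigma| := Ordinal (ltnW hd).
have ho : val o = 0%N by [].
pose A i := ovl_form o k i (dcoord p D f) (dcoord p D f').
have EE : E = fun n => (n%:R `^ (r%:R / 2)) ^+ 2 / 'C(n, k)%:R ^+ 2 *
    \sum_(i < n.+1) 'C(n, i)%:R * A i.
  by apply/funext => n; rewrite /E (expect_densityW hsum hD ho).
have A0 i : (2 * k - r < i)%N -> A i = 0.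
  move=> lt_i; have [fW _ _] := hf.
  have hc := (Wkr_coord hD ho f rk).1 fW.
  rewrite /A -{1}(subnKC rk); apply: ovl_form_gt hc _; lia.
have lim : E n @[n --> \oo] -->
     (k`!%:R ^+ 2 * inner p f f') / ((k + m)`!%:R * (k - r - m)`!%:R).
  have fact_neq0 j : j`!%:R != 0 :> R by rewrite pnatr_eq0 -lt0n fact_gt0.
  have lim_val : (k`!%:R ^+ 2 * inner p f f') / ((k + m)`!%:R * (k - r - m)`!%:R) =
      k`!%:R ^+ 2 / (2 * k - r)`!%:R * A (2 * k - r)%N.
    rewrite /A (Wkrm_form hD ho f' rk hm hf).
    (* The complement of [k - r - m] in [2 k - r] is [k + m], so the binomial from [Wkrm_form]
       cancels against [(2 k - r)!] and leaves the stated denominator. *)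
    have -> : (2 * k - r)`!%:R =
        'C(2 * k - r, k - r - m)%:R * ((k - r - m)`!%:R * (k + m)`!%:R) :> R.
      rewrite -!natrM -(@bin_fact (2 * k - r) (k - r - m)); last by lia.
      by congr (_ * (_ * _`!))%:R; lia.
    have bin_neq0 : 'C(2 * k - r, k - r - m)%:R != 0 :> R.
      by rewrite pnatr_eq0 -lt0n bin_gt0; lia.
    by field; rewrite !fact_neq0.
  by rewrite EE lim_val; exact: cvg_binomial_sum.
split=> // neq; suff f0 : inner p f f' = 0.
  by split => //; move: lim; rewrite f0 mulr0 mul0r.
(* For [a < b], the vector [h] is killed by [k - r - b + 1] deletions, hence by [k - r - a], and [g]
   is orthogonal to that larger kernel. *)
have orth (a b : nat) (g h : Wspace R Sigma k) : (a < b <= k - r)%N ->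
    Wkrm p D r a g -> Wkrm p D r b h -> inner p g h = 0.
  move=> /andP[ab bk] [_ _ og] [hW dh _]; apply: og => //.
  apply: (coord_eq0 hD); rewrite (coord_deletion_iter hD ho).
  have -> : (k - r - a = b - a.+1 + (k - r - b).+1)%N by lia.
  by rewrite iterD -(coord_deletion_iter hD ho) dh coord0 iter_del0.
have [mm'|m'm|/esym//] := ltngtP m m'.
  by apply: (orth m m') => //; rewrite mm'.
have inner_sym : inner p f f' = inner p f' f.
  by apply: eq_bigr => u _; rewrite mulrAC.
by rewrite inner_sym; apply: (orth m' m) => //; rewrite m'm.
Qed.
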